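(* Consider the mean-field ensemble Kalman RMLE iteration for the regularized least-squares problem defined with the balanced truncation reduced forward operator $\mathbf H_{\rm RLS,BT}$. As $i\to\infty$, for all $j=1,\dots,J$: (a) $\mathbb E\big[\mathbf P\widetilde{\mathbf v}_{i+1}^{(j)}\big]\to\mathbf P\boldsymbol\mu_{\rm pos,BT}$; (b) $\mathrm{Cov}\big[\mathbf P\widetilde{\mathbf v}_{i+1}^{(j)}\big]\to\mathbf P\boldsymbol\Gamma_{\rm pos,BT}\mathbf P^\top$, where $\boldsymbol\Gamma_{\rm pos,BT}=(\mathbf H_{\rm BT}^\top\boldsymbol\Gamma^{-1}\mathbf H_{\rm BT}+\boldsymbol\Gamma_{\rm pr}^{-1})^{-1}$ and $\boldsymbol\mu_{\rm pos,BT}=\boldsymbol\Gamma_{\rm pos,BT}\mathbf H_{\rm BT}^\top\boldsymbol\Gamma^{-1}\mathbf y$.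
   Context: Smoothing problem: the linear system $\dot{\mathbf x}(t)=\mathbf A\mathbf x(t)$ with $\mathbf A\in\mathbb R^{d\times d}$, output matrix $\mathbf F\in\mathbb R^{d_{\rm out}\times d}$, and unknown $\mathbf x(0)=\mathbf v$ is measured at times $0<t_1<\dots<t_m$: $\mathbf y_k=\mathbf F e^{\mathbf At_k}\mathbf v+\boldsymbol\eta_k$, $\boldsymbol\eta_k\sim\mathcal N(\mathbf 0,\boldsymbol\Gamma_\eta)$. Stack $\mathbf y=(\mathbf y_1;\dots;\mathbf y_m)\in\mathbb R^n$, $n=m\,d_{\rm out}$, and let $\boldsymbol\Gamma=\mathrm{blockdiag}(\boldsymbol\Gamma_\eta,\dots,\boldsymbol\Gamma_\eta)\in\mathbb R^{n\times n}$. The prior is $\mathbf v\sim\mathcal N(\mathbf 0,\boldsymbol\Gamma_{\rm pr})$. $\boldsymbol\Gamma_\eta$ and $\boldsymbol\Gamma_{\rm pr}$ are symmetric positive definite. Balanced truncation of order $\rho$: let $\mathbf Q=\int_0^\infty e^{\mathbf A^\top t}\mathbf F^\top\boldsymbol\Gamma_\eta^{-1}\mathbf Fe^{\mathbf At}\,dt$ (assumed convergent), $\boldsymbol\Gamma_{\rm pr}=\mathbf R\mathbf R^\top$, $\mathbf Q=\mathbf L\mathbf L^\top$, and let $\mathbf L^\top\mathbf R=\boldsymbol\Phi\boldsymbol\Xi\boldsymbol\Psi^\top$ be a singular value decomposition with singular values in non-increasing order. With $\boldsymbol\Phi_\rho,\boldsymbol\Psi_\rho$ the first $\rho$ columns of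 $\boldsymbol\Phi,\boldsymbol\Psi$ and $\boldsymbol\Xi_\rho$ the leading $\rho\times\rho$ block of $\boldsymbol\Xi$ (assumed invertible), set $\boldsymbol{\mathcal V}_\rho^\top=\boldsymbol\Xi_\rho^{-1/2}\boldsymbol\Phi_\rho^\top\mathbf L^\top$, $\boldsymbol{\mathcal U}_\rho=\mathbf R\boldsymbol\Psi_\rho\boldsymbol\Xi_\rho^{-1/2}$, $\widehat{\mathbf A}=\boldsymbol{\mathcal V}_\rho^\top\mathbf A\boldsymbol{\mathcal U}_\rho$, $\widehat{\mathbf F}=\mathbf F\boldsymbol{\mathcal U}_\rho$, and $$\mathbf H_{\rm BT}=\begin{bmatrix}\widehat{\mathbf F}e^{\widehat{\mathbf A}t_1}\\ \vdots\\ \widehat{\mathbf F}e^{\widehat{\mathbf A}t_m}\end{bmatrix}\boldsymbol{\mathcal V}_\rho^\top\in\mathbb R^{n\times d},\qquad \mathbf H_{\rm RLS,BT}=\begin{bmatrix}\mathbf H_{\rm BT}\\ \mathbf I\end{bmatrix}.$$ Put $\mathbf y_{\rm RLS}=\begin{bmatrix}\mathbf y\\ \mathbf 0\end{bmatrix}$, $\boldsymbol\Gamma_{\rm RLS}=\begin{bmatrix}\boldsymbol\Gamma&\\&\boldsymbol\Gamma_{\rm pr}\end{bmatrix}$, $\mathbf B=\mathbf H_{\rm RLS,BT}^\top\boldsymbol\Gamma_{\rm RLS}^{-1}\mathbf H_{\rm RLS,BT}$. Here $\mathbf y$ is fixed. Mean-field iteration: let $\dagger$ be the Moore–Penrose pseudoinverse.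 For $j=1,\dots,J$ the initial particles $\mathbf v_0^{(j)}\in\mathbb R^d$ are random with mean $\boldsymbol\mu_0$ and symmetric positive semidefinite covariance $\widetilde{\mathbf C}_0$; the perturbations $\boldsymbol\varepsilon^{(j)}\sim\mathcal N(\mathbf 0,\boldsymbol\Gamma_{\rm RLS})$ are i.i.d. and independent of the initial particles; $\mathbf y^{(j)}=\mathbf y_{\rm RLS}+\boldsymbol\varepsilon^{(j)}$, $\mathbf v_\star^{(j)}=\mathbf B^\dagger\mathbf H_{\rm RLS,BT}^\top\boldsymbol\Gamma_{\rm RLS}^{-1}\mathbf y^{(j)}$. For $i\ge0$ define recursively $\widetilde{\mathbf M}_i=(\mathbf I+\widetilde{\mathbf C}_i\mathbf B)^{-1}$, $\widetilde{\mathbf M}_{i:0}=\widetilde{\mathbf M}_i\cdots\widetilde{\mathbf M}_0$, $$\widetilde{\mathbf C}_{i+1}=\widetilde{\mathbf M}_{i:0}\widetilde{\mathbf C}_0\widetilde{\mathbf M}_{i:0}^\top+(\mathbf I-\widetilde{\mathbf M}_{i:0})\mathbf B^\dagger(\mathbf I-\widetilde{\mathbf M}_{i:0})^\top,\qquad \widetilde{\mathbf v}_{i+1}^{(j)}=\widetilde{\mathbf M}_{i:0}\mathbf v_0^{(j)}+(\mathbf I-\widetilde{\mathbf M}_{i:0})\mathbf v_\star^{(j)}.$$ Expectation and covariance are over the initial particles and the perturbations. The eigenvectors of $\widetilde{\mathbf C}_i\mathbf B$ can be taken independent of $i$. Let $r$ be the number of strictly positive eigenvalues (independent of $i$), $\mathbf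 U=[\mathbf u_1,\dots,\mathbf u_r]$ the matrix of corresponding eigenvectors normalized so that $\mathbf U^\top\mathbf B\mathbf U=\mathbf I_r$, and $\mathbf P=\mathbf U\mathbf U^\top\mathbf B$. *)

(* Defs.v *)
From mathcomp Require Export all_boot all_order all_algebra.
From mathcomp Require Export all_classical all_reals all_analysis.

Set Implicit Arguments.
Unset Strict Implicit.
Unset Printing Implicit Defensive.

Export Order.TTheory GRing.Theory Num.Theory.
Export numFieldNormedType.Exports.

Global Open Scope classical_set_scope.
Global Open Scope ring_scope.

(** * Linear algebra *)

Definition symmetric_mx (R : realType) n (S : 'M[R]_n) : Prop := S^T = S.

Definition spsd (R : realType) n (S : 'M[R]_n) : Prop :=
  symmetric_mx S /\ forall x : 'cV[R]_n, 0 <= (x^T *m S *m x) 0 0.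

Definition spd (R : realType) n (S : 'M[R]_n) : Prop :=
  symmetric_mx S /\
  forall x : 'cV[R]_n, x != 0 -> 0 < (x^T *m S *m x) 0 0.

Definition expmx (R : realType) n (A : 'M[R]_n) : 'M[R]_n :=
  limn (series (fun k : nat => k`!%:R^-1 *: (A ^+ k : 'M[R]_n))).

(* The four Penrose conditions.  They determine X, and for a real matrix a
   solution always exists, so the default of xget below is never used. *)
Definition penrose (R : realType) m n (A : 'M[R]_(m, n)) (X : 'M[R]_(n, m)) :
    Prop :=
  [/\ A *m X *m A = A, X *m A *m X = X,
      (A *m X)^T = A *m X & (X *m A)^T = X *m A].

Definition mpinv (R : realType) m n (A : 'M[R]_(m, n)) : 'M[R]_(n, m) :=
  xget 0 [set X | penrose A X].

(* Full singular value decomposition M = Phi Xi Psi^T of a rectangular matrix: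
   Phi, Psi orthogonal, Xi rectangular diagonal with nonnegative
   non-increasing diagonal. *)
Definition is_svd (R : realType) l p (M : 'M[R]_(l, p))
    (Phi : 'M[R]_l) (Xi : 'M[R]_(l, p)) (Psi : 'M[R]_p) : Prop :=
  [/\ M = Phi *m Xi *m Psi^T,
      Phi^T *m Phi = 1%:M /\ Psi^T *m Psi = 1%:M,
      is_diag_mx Xi,
      (forall (i : 'I_l) (j : 'I_p), i = j :> nat -> 0 <= Xi i j) &
      (forall (i i' : 'I_l) (j j' : 'I_p),
         i = j :> nat -> i' = j' :> nat -> (i <= i')%N -> Xi i' j' <= Xi i j)].

(* delta lists all strictly positive eigenvalues of K, with algebraic
   multiplicity, and column l of U is an eigenvector for delta l (nonzero as
   soon as U^T B U = I). *)
Definition positive_eigenpairs (R : realType) d r (K : 'M[R]_d)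
    (delta : 'I_r -> R) (U : 'M[R]_(d, r)) : Prop :=
  [/\ forall l, 0 < delta l,
      exists2 q : {poly R},
        char_poly K = (\prod_(l < r) ('X - (delta l)%:P)) * q
        & forall x : R, 0 < x -> ~~ root q x
    & forall l, K *m col l U = delta l *: col l U].

(** * Balanced truncation *)

Definition obs_integrand (R : realType) d dout (A : 'M[R]_d)
    (F : 'M[R]_(dout, d)) (Gamma_eta : 'M[R]_dout) (t : R) : 'M[R]_d :=
  expmx (t *: A^T) *m F^T *m invmx Gamma_eta *m F *m expmx (t *: A).

(* Entrywise Lebesgue integrability on [0, +oo[.  The integrand is continuous
   and positive semidefinite, so this is the same as convergence of the improper
   integral. *)
Definition obs_gramian_converges (R : realType) d dout (A : 'M[R]_d)
    (F : 'M[R]_(dout, d)) (Gamma_eta : 'M[R]_dout) : Prop :=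
  forall i j : 'I_d, (@lebesgue_measure R).-integrable `[0, +oo[
    (fun t => (obs_integrand A F Gamma_eta t i j)%:E).

Definition obs_gramian (R : realType) d dout (A : 'M[R]_d)
    (F : 'M[R]_(dout, d)) (Gamma_eta : 'M[R]_dout) : 'M[R]_d :=
  \matrix_(i, j)
    Rintegral (@lebesgue_measure R) `[0, +oo[
      (fun t => obs_integrand A F Gamma_eta t i j).

Definition first_cols (R : realType) n k rho (h : (rho <= k)%N)
    (M : 'M[R]_(n, k)) : 'M[R]_(n, rho) := colsub (widen_ord h) M.

Definition leading_block (R : realType) l p rho (hl : (rho <= l)%N)
    (hp : (rho <= p)%N) (Xi : 'M[R]_(l, p)) : 'M[R]_rho :=
  mxsub (widen_ord hl) (widen_ord hp) Xi.

(* The power -1/2 of a diagonal matrix with positive diagonal. *)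
Definition diag_invsqrt (R : realType) n (D : 'M[R]_n) : 'M[R]_n :=
  diag_mx (\row_i (Num.sqrt (D i i))^-1).

Definition bt_Vt (R : realType) d l p rho (hl : (rho <= l)%N)
    (hp : (rho <= p)%N) (L : 'M[R]_(d, l)) (Phi : 'M[R]_l)
    (Xi : 'M[R]_(l, p)) : 'M[R]_(rho, d) :=
  diag_invsqrt (leading_block hl hp Xi) *m (first_cols hl Phi)^T *m L^T.

Definition bt_U (R : realType) d l p rho (hl : (rho <= l)%N)
    (hp : (rho <= p)%N) (Rpr : 'M[R]_(d, p)) (Xi : 'M[R]_(l, p))
    (Psi : 'M[R]_p) : 'M[R]_(d, rho) :=
  Rpr *m first_cols hp Psi *m diag_invsqrt (leading_block hl hp Xi).

(* The block column of the Fhat e^(Ahat t_k) V^T; n = m * dout appears as a sum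
   of m copies of dout. *)
Definition bt_H (R : realType) d dout m rho (A : 'M[R]_d)
    (F : 'M[R]_(dout, d)) (t : 'I_m -> R) (Vt : 'M[R]_(rho, d))
    (U : 'M[R]_(d, rho)) : 'M[R]_(\sum_(k < m) dout, d) :=
  (\mxcol_(k < m) (F *m U *m expmx (t k *: (Vt *m A *m U)))) *m Vt.

Definition stack_noise_cov (R : realType) dout m (Gamma_eta : 'M[R]_dout) :
    'M[R]_(\sum_(k < m) dout) := \mxdiag_(k < m) Gamma_eta.

(** * Mean-field iteration *)

(* State before step i: the pair of C_i and M_(i-1) ... M_0 (I when i = 0). *)
Fixpoint mf_state (R : realType) d (B C0 : 'M[R]_d) (i : nat) :
    'M[R]_d * 'M[R]_d :=
  if i is i'.+1 then
    let: (C, N) := mf_state B C0 i' in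
    let N' := invmx (1%:M + C *m B) *m N in
    (N' *m C0 *m N'^T + (1%:M - N') *m mpinv B *m (1%:M - N')^T, N')
  else (C0, 1%:M).

Definition mf_C (R : realType) d (B C0 : 'M[R]_d) (i : nat) : 'M[R]_d :=
  (mf_state B C0 i).1.

(* M_{i:0} = M_i ... M_0 *)
Definition mf_Mprod (R : realType) d (B C0 : 'M[R]_d) (i : nat) : 'M[R]_d :=
  (mf_state B C0 i.+1).2.

(* The particle of index i + 1. *)
Definition mf_vS (R : realType) d (B C0 : 'M[R]_d) (v0 vstar : 'cV[R]_d)
    (i : nat) : 'cV[R]_d :=
  mf_Mprod B C0 i *m v0 + (1%:M - mf_Mprod B C0 i) *m vstar.

(** * Random vectors *)

Section random_vectors.
Context {R : realType} {disp : measure_display} {Omega : measurableType disp}.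
Variable P : probability Omega R.

Definition random_vector n (X : Omega -> 'cV[R]_n) : Prop :=
  forall k, measurable_fun setT (fun w => X w k 0).

Definition mean_vec n (X : Omega -> 'cV[R]_n) : 'cV[\bar R]_n :=
  \col_k 'E_P[(fun w => X w k 0)%R]%E.

Definition cov_mx n (X : Omega -> 'cV[R]_n) : 'M[\bar R]_n :=
  \matrix_(k, l) covariance P (fun w => X w k 0) (fun w => X w l 0).

(* X ~ N(mu, Sigma): every linear functional a^T X is univariate normal with
   mean a^T mu and variance a^T Sigma a.  normal_prob is parametrized by the
   standard deviation and is not the point mass when that is 0. *)
Definition gaussian_vector n (X : Omega -> 'cV[R]_n) (mu : 'cV[R]_n)
    (Sigma : 'M[R]_n) : Prop :=
  random_vector X /\
  forall (a : 'cV[R]_n) (E : set R), measurable E ->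
    let mean := (a^T *m mu) 0 0 in
    let var := (a^T *m Sigma *m a) 0 0 in
    P [set w | E ((a^T *m X w) 0 0)] =
      if var == 0 then dirac mean E else normal_prob mean (Num.sqrt var) E.

Definition sigma_generated (I : Type) n (X : I -> Omega -> 'cV[R]_n) :
    set (set Omega) :=
  <<s [set A | exists i k (E : set R),
         measurable E /\ A = [set w | E (X i w k 0)]] >>.

Definition independent (G H : set (set Omega)) : Prop :=
  forall A B, G A -> H B -> (P (A `&` B) = P A * P B)%E.

Definition mutually_independent (I : finType) (G : I -> set (set Omega)) :
    Prop :=
  forall (S : {set I}) (A : I -> set Omega),
    (forall i, i \in S -> G i (A i)) ->
    (P (\bigcap_(i in [set i | i \in S]) A i) = \prod_(i in S) P (A i))%E.

End random_vectors.

(* Main.v *)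
From HB Require Import structures.
Require Import Defs.
From mathcomp Require Import ring lra measurable_realfun.

Set Implicit Arguments.
Unset Strict Implicit.
Unset Printing Implicit Defensive.

(** The matrix B is the precision H_BT^T Gamma^-1 H_BT + Gamma_pr^-1 of the
    reduced posterior.  It is positive definite, so its pseudoinverse is its
    inverse Gamma_pos, and the gain K = B^-1 H_RLS^T Gamma_RLS^-1 satisfies
    K y_RLS = mu_pos and K Gamma_RLS K^T = B^-1 = Gamma_pos.

    Everything then rests on P M_(i:0) -> 0.  As C_i B is self-adjoint for the
    inner product defined by B, the right eigenvectors U provide left
    eigenvectors U^T B with the same eigenvalues; hence
    U^T B M_(i:0) = diag(lam_i) U^T B, where each step divides lam by 1 plus the
    current eigenvalue of C_i B.  Conjugating the recursion for C_i by B U gives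
    that eigenvalue as lam^2 delta_0 + (1 - lam)^2, which is never below
    delta_0 / (1 + delta_0) > 0: the eigenvalues do not die out and lam decays
    geometrically ([mf_spectral_decay], [mf_projected_Mprod_cvg0]).

    The projected particle is an affine function of the stacked vector
    (v_0; eps), with matrix (P M, (P - P M) K) tending to (0, P K)
    ([projected_particleE]).  The mean and covariance of a square-integrable
    vector transform as M z + b and M S M^T under affine maps, so they converge
    as soon as the matrices do ([moments_affine_cvg]): the limits are
    P K y_RLS = P mu_pos and P K Gamma_RLS K^T P^T = P Gamma_pos P^T.

    The moments of the perturbations must be extracted from the law of their
    linear functionals.  Centred normal laws are symmetric, which gives mean 0;
    the second moment is computed by the fundamental theorem of calculus
    ([normal_second_moment]), and polarization yields the covariance matrix
    ([gaussian_cov_mx]). *)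

(** * Positive definite matrices *)

Lemma unitmx_ker0 (R : realType) n (S : 'M[R]_n) :
  (forall x : 'cV[R]_n, S *m x = 0 -> x = 0) -> S \in unitmx.
Proof.
move=> S0; rewrite -unitmx_tr -row_free_unit -kermx_eq0;
  apply/eqP/row_matrixP => i.
rewrite row0; apply: trmx_inj; rewrite trmx0; apply: S0.
by rewrite -{1}[S]trmxK -trmx_mul -row_mul mulmx_ker row0 trmx0.
Qed.

Lemma spd_unitmx (R : realType) n (S : 'M[R]_n) : spd S -> S \in unitmx.
Proof.
move=> [_ S_gt0]; apply: unitmx_ker0 => x Sx0.
apply: contraTeq isT => /S_gt0; by rewrite -mulmxA Sx0 mulmx0 mxE ltxx.
Qed.

Lemma spd_spsd (R : realType) n (S : 'M[R]_n) : spd S -> spsd S.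
Proof.
move=> [St S_gt0]; split=> // x; have [->|/S_gt0/ltW//] := eqVneq x 0.
by rewrite mulmx0 mxE.
Qed.

Lemma spd_congr (R : realType) m n (S : 'M[R]_m) (H : 'M[R]_(m, n)) :
  spd S -> (forall x : 'cV[R]_n, H *m x = 0 -> x = 0) -> spd (H^T *m S *m H).
Proof.
move=> [St S_gt0] H0; split.
  by rewrite /symmetric_mx !trmx_mul trmxK St mulmxA.
move=> x x0; rewrite !mulmxA -trmx_mul -!mulmxA mulmxA; apply: S_gt0.
by apply: contra_neq x0 => /H0.
Qed.

Lemma spsd_congr (R : realType) m n (S : 'M[R]_m) (H : 'M[R]_(n, m)) :
  spsd S -> spsd (H *m S *m H^T).
Proof.
move=> [St S_ge0]; split.
  by rewrite /symmetric_mx !trmx_mul trmxK St mulmxA.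
move=> x; have := S_ge0 (H^T *m x).
by rewrite trmx_mul trmxK !mulmxA.
Qed.

Lemma spsdD (R : realType) n (S T : 'M[R]_n) : spsd S -> spsd T -> spsd (S + T).
Proof.
move=> [St S_ge0] [Tt T_ge0]; split.
  by rewrite /symmetric_mx linearD/= St Tt.
by move=> x; rewrite mulmxDr mulmxDl mxE addr_ge0.
Qed.

Lemma spd_invmx (R : realType) n (S : 'M[R]_n) : spd S -> spd (invmx S).
Proof.
move=> Sspd; have Su := spd_unitmx Sspd.
have -> : invmx S = (invmx S)^T *m S *m invmx S.
  by rewrite trmx_inv Sspd.1 mulVmx// mul1mx.
apply: spd_congr => // x; move/(congr1 (mulmx S)).
by rewrite mulmxA mulmxV// mul1mx mulmx0.
Qed.

Lemma spd_block_diag (R : realType) m n (S : 'M[R]_m) (T : 'M[R]_n) :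
  spd S -> spd T -> spd (block_mx S 0 0 T).
Proof.
move=> Sspd Tspd; have [_ S_ge0] := spd_spsd Sspd;
  have [_ T_ge0] := spd_spsd Tspd.
case: Sspd Tspd => [St S_gt0] [Tt T_gt0]; split.
  by rewrite /symmetric_mx tr_block_mx !trmx0 St Tt.
move=> x; rewrite -[x]vsubmxK; set u := usubmx x; set v := dsubmx x => uv0.
rewrite tr_col_mx mul_row_block !mulmx0 addr0 add0r mul_row_col mxE.
have [u0|u0] := eqVneq u 0; last by apply: ltr_wpDr (T_ge0 v) (S_gt0 u u0).
apply: ltr_wpDl (S_ge0 u) (T_gt0 v _); apply: contra_neq uv0 => ->.
by rewrite u0 col_mx0.
Qed.

Lemma spd_mxdiag (R : realType) p n (S : 'M[R]_n) :
  spd S -> spd (\mxdiag_(k < p) S).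
Proof.
move=> Sspd; have [_ S_ge0] := spd_spsd Sspd; case: Sspd => [St S_gt0]; split.
  by rewrite /symmetric_mx tr_mxdiag; apply: eq_mxdiag.
move=> x x0; rewrite -[x]submxcolK tr_mxcol -mulmxA mul_mxdiag_mxcol.
rewrite mul_mxrow_mxcol summxE.
have q_ge0 k : 0 <= ((submxcol x k)^T *m (S *m submxcol x k)) 0 0.
  by rewrite mulmxA; exact: S_ge0.
rewrite lt_neqAle sumr_ge0 ?andbT; last by move=> k _; exact: q_ge0.
apply: contra_neq x0 => /esym/psumr_eq0P q0.
rewrite -[x]submxcolK -mxcol0; apply/eq_mxcolP => k.
apply: contraTeq isT => /S_gt0.
by rewrite -mulmxA q0 ?ltxx// => j _; exact: q_ge0.
Qed.

Lemma invmx_block_diag (R : realType) m n (S : 'M[R]_m) (T : 'M[R]_n) :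
  S \in unitmx -> T \in unitmx ->
  invmx (block_mx S 0 0 T) = block_mx (invmx S) 0 0 (invmx T).
Proof.
move=> Su Tu.
have VS : block_mx (invmx S) 0 0 (invmx T) *m block_mx S 0 0 T = 1%:M.
  by rewrite mulmx_block !mulmx0 !mul0mx !mulVmx// !addr0 add0r
    -scalar_mx_block.
have [_ ST_unit] := mulmx1_unit VS.
by rewrite -[RHS]mulmx1 -(mulmxV ST_unit) mulmxA VS mul1mx.
Qed.

Lemma mpinv_unitmx (R : realType) n (S : 'M[R]_n) :
  S \in unitmx -> mpinv S = invmx S.
Proof.
move=> Su; rewrite /mpinv; case: xgetP => [X _ [SXS _ _ _]|/(_ (invmx S))[]].
  have : invmx S *m (S *m X *m S) *m invmx S = invmx S *m S *m invmx S.
    by rewrite SXS.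
  by rewrite !mulmxA mulVmx// !mul1mx mulmxK.
by split; rewrite ?mulmxV ?mulVmx ?mul1mx ?trmx1.
Qed.

(** If (1 + C B) x = 0 then x^T B x = - (B x)^T C (B x), which has the wrong
    sign unless x = 0. *)
Lemma unitmx1D_mul (R : realType) n (C B : 'M[R]_n) :
  spsd C -> spd B -> 1%:M + C *m B \in unitmx.
Proof.
move=> [_ C_ge0] [Bt B_gt0]; apply: unitmx_ker0 => x.
rewrite mulmxDl mul1mx -mulmxA => /eqP; rewrite addr_eq0 => /eqP xE.
apply: contraTeq isT => /B_gt0; rewrite ltNge => /negP[].
have -> : (x^T *m B *m x) = - ((B *m x)^T *m C *m (B *m x)).
  by rewrite trmx_mul Bt {2}xE mulmxN !mulmxA.
by rewrite mxE oppr_le0.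
Qed.

(** * The mean-field iteration in the eigenbasis *)

(** At i = 0 the accumulated product is the identity, so the initial covariance
    has the same form as the later ones and the induction below needs no special
    case. *)
Lemma mf_CE (R : realType) d (B C0 : 'M[R]_d) i (N := (mf_state B C0 i).2) :
  mf_C B C0 i = N *m C0 *m N^T + (1%:M - N) *m mpinv B *m (1%:M - N)^T.
Proof.
rewrite /mf_C {}/N; case: i => [|i] /=.
  by rewrite trmx1 mulmx1 mul1mx subrr !mul0mx addr0.
by case: mf_state.
Qed.

Lemma mf_stateS (R : realType) d (B C0 : 'M[R]_d) i :
  (mf_state B C0 i.+1).2 =
  invmx (1%:M + mf_C B C0 i *m B) *m (mf_state B C0 i).2.
Proof. by rewrite /mf_C /=; case: mf_state. Qed.

Lemma spsd_mf_C (R : realType) d (B C0 : 'M[R]_d) i :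
  spd B -> spsd C0 -> spsd (mf_C B C0 i).
Proof.
move=> Bspd C0spsd; rewrite mf_CE mpinv_unitmx ?spd_unitmx//.
by apply: spsdD; apply: spsd_congr => //; apply: spd_spsd; exact: spd_invmx.
Qed.

(** The minimum over lam of lam^2 x + (1 - lam)^2, reached at
    lam = 1 / (1 + x). *)
Definition eigen_floor (R : realType) (x : R) : R := x / (1 + x).

Lemma eigen_floor_le (R : realType) (x lam : R) : 0 < x ->
  eigen_floor x <= lam ^+ 2 * x + (1 - lam) ^+ 2.
Proof.
move=> x0; have x1 : 0 < 1 + x by rewrite addr_gt0.
rewrite ler_pdivrMr// -subr_ge0.
have -> : (lam ^+ 2 * x + (1 - lam) ^+ 2) * (1 + x) - x =
  ((1 + x) * lam - 1) ^+ 2 by ring.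
exact: sqr_ge0.
Qed.

(** C B is self-adjoint for the inner product (x, y) |-> x^T B y, so a right
    eigenvector u gives the left eigenvector u^T B. *)
Lemma eigen_left (R : realType) d r (C B : 'M[R]_d) (U : 'M[R]_(d, r))
    (delta : 'I_r -> R) :
  C^T = C -> B^T = B -> (forall l, (C *m B) *m col l U = delta l *: col l U) ->
  U^T *m B *m C *m B = diag_mx (\row_l delta l) *m (U^T *m B).
Proof.
move=> Ct Bt CBU.
have CBUE : C *m B *m U = U *m diag_mx (\row_l delta l).
  apply/matrixP => i l; have /matrixP/(_ i 0) := CBU l.
  by rewrite colE mulmxA -!colE mul_mx_diag !mxE mulrC.
apply: trmx_inj; rewrite !trmx_mul !trmxK Bt Ct tr_diag_mx -!mulmxA.
by congr (_ *m _); rewrite mulmxA CBUE.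
Qed.

Lemma eigen_invmx_left (R : realType) d r (K : 'M[R]_d) (W : 'M[R]_(r, d))
    (delta : 'I_r -> R) :
  1%:M + K \in unitmx -> (forall l, 0 < delta l) ->
  W *m K = diag_mx (\row_l delta l) *m W ->
  W *m invmx (1%:M + K) = diag_mx (\row_l (1 + delta l)^-1) *m W.
Proof.
move=> Ku d_gt0 WK.
have WK1 : W *m (1%:M + K) = diag_mx (\row_l (1 + delta l)) *m W.
  rewrite mulmxDr mulmx1 WK -{1}[W]mul1mx -mulmxDl; congr (_ *m _).
  by apply/matrixP => i j; rewrite !mxE; case: eqP => _;
    rewrite ?mulr1n ?mulr0n ?addr0.
have DW : diag_mx (\row_l (1 + delta l)^-1) *m
    (diag_mx (\row_l (1 + delta l)) *m W) = W.
  apply/matrixP => i j; rewrite !mul_diag_mx !mxE mulrA mulVf ?mul1r//.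
  by rewrite gt_eqF// addr_gt0.
by rewrite -[in LHS]DW -WK1 -mulmxA mulmxK.
Qed.

(** The accumulated product acts diagonally on the common eigenbasis, and the
    recursion for C_i then expresses its eigenvalues through lam and delta0
    ([deltaE] in the proof).  As they stay above the floor, each step contracts
    lam by a factor that does not depend on i. *)
Lemma mf_spectral_decay (R : realType) d r (B C0 : 'M[R]_d) (U : 'M[R]_(d, r))
    (delta0 : 'I_r -> R) :
  spd B -> spsd C0 ->
  (forall l, 0 < delta0 l) ->
  (forall l, C0 *m B *m col l U = delta0 l *: col l U) ->
  (forall i, exists delta : 'I_r -> R, (forall l, 0 < delta l) /\
     forall l, mf_C B C0 i *m B *m col l U = delta l *: col l U) ->
  U^T *m B *m U = 1%:M ->
  forall i, exists lam : 'I_r -> R,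
    U^T *m B *m (mf_state B C0 i).2 = diag_mx (\row_l lam l) *m (U^T *m B) /\
    forall l, 0 <= lam l <= (1 + eigen_floor (delta0 l))^-1 ^+ i.
Proof.
move=> Bspd C0spsd d0_gt0 CBU0 CBU UBU; have Bt := Bspd.1.
have fl_gt0 l : 0 < 1 + eigen_floor (delta0 l).
  by rewrite addr_gt0// divr_gt0// addr_gt0.
have UBCB0 := eigen_left C0spsd.1 Bt CBU0.
elim=> [|i [lam [lamN lam_bnd]]].
  exists (fun=> 1) => /=; rewrite mulmx1; split; last first.
    by move=> l; rewrite ler01 expr0 lexx.
  by rewrite (_ : \row__ _ = const_mx 1) ?diag_const_mx ?mul1mx//;
    apply/matrixP => a b; rewrite !mxE.
have [delta [d_gt0 CBUi]] := CBU i.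
have Ci := spsd_mf_C i Bspd C0spsd.
have UBCB := eigen_left Ci.1 Bt CBUi.
have deltaE l : delta l = lam l ^+ 2 * delta0 l + (1 - lam l) ^+ 2.
  set N := (mf_state B C0 i).2 in lamN *.
  set W := U^T *m B in lamN UBCB UBCB0.
  have tW : W^T = B *m U by rewrite /W trmx_mul trmxK Bt.
  have WN1 : W *m (1%:M - N) = diag_mx (\row_l (1 - lam l)) *m W.
    rewrite mulmxBr mulmx1 lamN -{1}[W]mul1mx -mulmxBl; congr (_ *m _).
    by apply/matrixP => a b; rewrite !mxE; case: eqP => _;
      rewrite ?mulr1n ?mulr0n ?subr0.
  have WCW : W *m mf_C B C0 i *m W^T = diag_mx (\row_l delta l).
    by rewrite tW !mulmxA UBCB -mulmxA UBU mulmx1.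
  have WC0W : W *m C0 *m W^T = diag_mx (\row_l delta0 l).
    by rewrite tW !mulmxA UBCB0 -mulmxA UBU mulmx1.
  have WBW : W *m invmx B *m W^T = 1%:M.
    by rewrite tW mulmxA mulmxKV ?spd_unitmx.
  have : W *m mf_C B C0 i *m W^T =
      (W *m N) *m C0 *m (W *m N)^T +
      (W *m (1%:M - N)) *m invmx B *m (W *m (1%:M - N))^T.
    rewrite mf_CE mpinv_unitmx ?spd_unitmx// -/N mulmxDr mulmxDl.
    by rewrite !trmx_mul !mulmxA.
  (* W must be opaque, or rewriting would unfold the products inside it. *)
  clearbody W; rewrite WCW lamN WN1 !trmx_mul !tr_diag_mx -!mulmxA.
  rewrite !(mulmxA W) !(mulmxA (W *m _)) WC0W WBW mul1mx.
  rewrite !mul_diag_mx => /matrixP/(_ l l); rewrite !mxE eqxx !mulr1n => ->.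
  by rewrite !expr2 -mulrA [_ * delta0 l]mulrC.
exists (fun l => lam l / (1 + delta l)); split.
  rewrite mf_stateS [LHS]mulmxA.
  rewrite (@eigen_invmx_left _ _ _ _ (U^T *m B) _ (unitmx1D_mul Ci Bspd) d_gt0).
    rewrite -mulmxA lamN mulmxA; congr (_ *m _).
    by apply/matrixP => a b; rewrite mul_diag_mx !mxE mulrnAr mulrC.
  by rewrite !mulmxA in UBCB *.
move=> l; have /andP[lam0 lam_le] := lam_bnd l.
have d1_gt0 : 0 < 1 + delta l by rewrite addr_gt0.
rewrite divr_ge0 ?(ltW d1_gt0)//= exprSr ler_pM// ?invr_ge0 ?(ltW d1_gt0)//.
by rewrite lef_pV2 ?posrE// lerD2l deltaE eigen_floor_le.
Qed.

(** * Second moment of the normal law *)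

(** Change of variables holds for the abstract Radon-Nikodym derivative, which
    agrees almost everywhere with the explicit density. *)
Lemma ge0_integral_normal_prob (R : realType) (m s : R) (f : R -> \bar R) :
  (forall x, 0 <= f x)%E -> measurable_fun setT f ->
  (\int[normal_prob m s]_x f x =
   \int[@lebesgue_measure R]_x (f x * (normal_pdf m s x)%:E))%E.
Proof.
move=> f_ge0 mf.
have dom := normal_prob_dominates m s.
rewrite -(Radon_Nikodym_SigmaFinite.change_of_variables dom)//.
have iRN := Radon_Nikodym_SigmaFinite.f_integrable dom.
apply: ae_eq_integral => //.
- by apply: emeasurable_funM => //; exact: measurable_int iRN.
- by apply: emeasurable_funM => //; apply/measurable_EFinP;
    exact: measurable_normal_pdf.
apply: ae_eqe_mul2l; apply: integral_ae_eq => //.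
  by apply/measurable_EFinP; exact: measurable_normal_pdf.
by move=> E _ mE; rewrite -Radon_Nikodym_SigmaFinite.f_integral.
Qed.

Section centred_normal.
Variables (R : realType) (s : R).
Hypothesis s_neq0 : s != 0.
Let phi : R -> R := normal_pdf 0 s.
Let mu := @lebesgue_measure R.

Let phi_even x : phi (- x) = phi x.
Proof. by rewrite /phi !normal_pdfE// /normal_fun !subr0 sqrrN. Qed.

Let continuous_phi : continuous phi.
Proof. exact: continuous_normal_pdf. Qed.

Let is_derive_phi (x : R) : is_derive x 1 phi (- (x / s ^+ 2) * phi x).
Proof.
rewrite /phi normal_pdfE// /normal_fun.
apply: is_derive_eq; rewrite /GRing.scale/=; field.
by rewrite s_neq0.
Qed.

#[local] Existing Instance is_derive_phi.

Let Phi (x : R) : R := \int[mu]_(t in `]-oo, x]) phi t.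

Let is_derive_Phi (x : R) : is_derive x 1 Phi (phi x).
Proof.
have x1 : x < x + 1 by rewrite ltrDl.
have [] := @continuous_FTC1 R phi -oo%O x (x + 1) x1.
- by apply: integrableS (integrable_normal_pdf 0 s).
- by rewrite ltNyr.
- exact: continuous_phi.
by move=> dPhi Phi'; apply: DeriveDef => //; rewrite -derive1E.
Qed.

#[local] Existing Instance is_derive_Phi.

Let idTR : measurableTypeR R -> R := idfun.

#[local] HB.instance Definition _ :=
  @isMeasurableFun.Build _ _ _ _ idTR (@measurable_id _ _ setT).

Let cvg_Phi : Phi x @[x --> +oo] --> (1 : R).
Proof.
exact: fine_cvg (cvg_cdfy1 (idTR : {RV (normal_prob 0 s) >-> R})).
Qed.

(* From expR u >= u with u = x^2 / (2 s^2): x phi(x) is O(1 / x). *)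
Let cvg_xphi : x * phi x @[x --> +oo] --> (0 : R).
Proof.
have c_gt0 : 0 < s ^+ 2 *+ 2 by rewrite pmulrn_lgt0// exprn_even_gt0.
apply: (@squeeze_cvgr _ _ _ _ (cst 0)
    (fun x => normal_peak s * (s ^+ 2 *+ 2) * x^-1)).
- near=> x; have x_gt0 : 0 < x by near: x; exact: nbhs_pinfty_gt.
  apply/andP; split; first by rewrite mulr_ge0 ?(ltW x_gt0) ?normal_pdf_ge0.
  rewrite /phi normal_pdfE// mulrCA -mulrA ler_wpM2l ?normal_peak_ge0//.
  rewrite /normal_fun subr0 mulNr expRN ler_pdivrMr ?expR_gt0//.
  rewrite mulrAC ler_pdivlMr// -expr2 mulrC -ler_pdivrMr//.
  by apply: le_trans (expR_ge1Dx _); rewrite lerDr.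
- exact: cvg_cst.
- rewrite -[X in _ --> X](mulr0 (normal_peak s * (s ^+ 2 *+ 2))).
  apply: cvgM; first exact: cvg_cst.
  by apply/gtr0_cvgV0; [exact: nbhs_pinfty_gt|exact: cvg_id].
Unshelve. all: by end_near. Qed.

(* phi is even with integral 1, and its integral over [0, +oo[ is 1 - Phi 0. *)
Let Phi0 : Phi 0 = 2^-1.
Proof.
have := integral_normal_pdf 0 s.
rewrite (ge0_symfun_integralT (normal_pdf_ge0 0 s) continuous_phi)//;
  last first.
  by move=> x; rewrite /= -/phi phi_even.
rewrite -set_itvcy (@ge0_continuous_FTC2y _ _ Phi _ 1).
- by rewrite -EFinB -EFinM => -[] Phi0E; lra.
- by move=> x _; exact: normal_pdf_ge0.
- exact: continuous_subspaceT.
- exact: cvg_Phi.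
- by move=> x _; case: (is_derive_Phi x).
- apply: cvg_at_right_filter; apply: differentiable_continuous;
    apply/derivable1_diffP.
  by case: (is_derive_Phi 0).
- by move=> x _; rewrite derive1E; case: (is_derive_Phi x).
Qed.

(** With phi the density and Phi the distribution function, x^2 phi(x) is the
    derivative of s^2 (Phi(x) - x phi(x)) because phi'(x) = - x phi(x) / s^2.
    By evenness it suffices to integrate over [0, +oo[, where the integrand is
    nonnegative and the primitive increases from s^2 / 2 to s^2. *)
Lemma normal_second_moment :
  (\int[mu]_x (x ^+ 2 * phi x)%:E = (s ^+ 2)%:E)%E.
Proof.
rewrite ge0_symfun_integralT//=; last 3 first.
- by move=> x; rewrite mulr_ge0 ?sqr_ge0 ?normal_pdf_ge0.
- by move=> x; apply: cvgM; [exact: exprn_continuous|exact: continuous_phi].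
- by move=> x; rewrite /= sqrrN phi_even.
rewrite -set_itvcy.
pose G x := s ^+ 2 * (Phi x - x * phi x).
have dG (x : R) : is_derive x 1 G (x ^+ 2 * phi x).
  by rewrite /G; apply: is_derive_eq; rewrite /GRing.scale/=; field.
rewrite (@ge0_continuous_FTC2y _ _ G _ (s ^+ 2)).
- rewrite -EFinB -EFinM /G Phi0 mul0r subr0; congr EFin; lra.
- by move=> x _; rewrite mulr_ge0 ?sqr_ge0 ?normal_pdf_ge0.
- apply: continuous_subspaceT => x; apply: cvgM;
    [exact: exprn_continuous|exact: continuous_phi].
- suff : G x @[x --> +oo] --> s ^+ 2 * (1 - 0) by rewrite subr0 mulr1.
  apply: cvgM; first exact: cvg_cst.
  exact: cvgB cvg_Phi cvg_xphi.
- by move=> x _; case: (dG x).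
- apply: cvg_at_right_filter; apply: differentiable_continuous;
    apply/derivable1_diffP.
  by case: (dG 0).
- by move=> x _; rewrite derive1E; case: (dG x).
Qed.
End centred_normal.

(** * Affine images of square-integrable random vectors *)

Section square_integrable.
Context (R : realType) (disp : measure_display) (Omega : measurableType disp)
  (P : probability Omega R).
Implicit Types X Y : Omega -> R.

Let PT_fin : P setT \is a fin_num := fin_num_measure P _ measurableT.

Lemma Lfun2_sqr_lty X : measurable_fun setT X ->
  (\int[P]_w (X w ^+ 2)%:E < +oo)%E -> X \in Lfun P 2%:E.
Proof.
move=> mX intX2; rewrite inE; apply/andP; split; rewrite inE//=.
rewrite /finite_norm unlock poweR_lty//.
rewrite (eq_integral (fun w => (X w ^+ 2)%:E))// => w _ /=.
by rewrite powR_mulrn// real_normK// num_real.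
Qed.

Lemma Lfun2D X Y : X \in Lfun P 2%:E -> Y \in Lfun P 2%:E ->
  X \+ Y \in Lfun P 2%:E.
Proof. by move=> X2 Y2; rewrite rpredD//= lee1n. Qed.

Lemma Lfun2_lin (I : Type) (s : seq I) (a : I -> R) (f : I -> Omega -> R) :
  (forall i, f i \in Lfun P 2%:E) ->
  (fun w => \sum_(i <- s) a i * f i w) \in Lfun P 2%:E.
Proof.
move=> f2; elim: s => [|i s IHs].
  by under eq_fun do rewrite big_nil; exact: Lfun_cst.
under eq_fun do rewrite big_cons mulrC.
by apply: Lfun2D => //; apply: Lfun_scale => //; rewrite ler1n.
Qed.

Lemma Lfun12 X : X \in Lfun P 2%:E -> X \in Lfun P 1.
Proof. exact: Lfun_subset12. Qed.

Lemma expectation_lin (I : Type) (s : seq I) (a c : I -> R)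
    (f : I -> Omega -> R) :
  (forall i, f i \in Lfun P 2%:E) -> (forall i, 'E_P[f i]%E = (c i)%:E) ->
  'E_P[(fun w => \sum_(i <- s) a i * f i w)%R]%E = (\sum_(i <- s) a i * c i)%:E.
Proof.
move=> f2 Ef; elim: s => [|i s IHs].
  by under eq_fun do rewrite big_nil; rewrite big_nil; exact: expectation_cst.
under eq_fun do rewrite big_cons mulrC.
rewrite big_cons EFinD -IHs EFinM -Ef -expectationZl ?Lfun12//.
apply: expectationD; apply: Lfun12; last exact: Lfun2_lin.
by apply: Lfun_scale => //; rewrite ler1n.
Qed.

Lemma covariance_linl (I : Type) (s : seq I) (a c : I -> R)
    (f : I -> Omega -> R) Y :
  (forall i, f i \in Lfun P 2%:E) -> Y \in Lfun P 2%:E ->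
  (forall i, covariance P (f i) Y = (c i)%:E) ->
  covariance P (fun w => \sum_(i <- s) a i * f i w) Y =
  (\sum_(i <- s) a i * c i)%:E.
Proof.
move=> f2 Y2 Cf; elim: s => [|i s IHs].
  by under eq_fun do rewrite big_nil; rewrite big_nil; exact: covariance_cst_l.
under eq_fun do rewrite big_cons mulrC.
rewrite big_cons EFinD -IHs EFinM -Cf -covarianceZl;
  [|exact: Lfun12|exact: Lfun12|exact: Lfun2_mul_Lfun1].
apply: covarianceDl => //; first by apply: Lfun_scale => //; rewrite ler1n.
exact: Lfun2_lin.
Qed.

Lemma covarianceD_cst_l X Y b : X \in Lfun P 2%:E -> Y \in Lfun P 2%:E ->
  covariance P (fun w => X w + b) Y = covariance P X Y.
Proof.
move=> X2 Y2; have -> : (fun w => X w + b) = X \+ cst b by [].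
by rewrite covarianceDl ?Lfun_cst// covariance_cst_l adde0.
Qed.

Definition L2_vector n (Z : Omega -> 'cV[R]_n) : Prop :=
  forall k, (fun w => Z w k 0) \in Lfun P 2%:E.

Lemma L2_vector_affine m n (Z : Omega -> 'cV[R]_n) (M : 'M[R]_(m, n)) b :
  L2_vector Z -> L2_vector (fun w => M *m Z w + b).
Proof.
move=> Z2 k; under eq_fun do rewrite !mxE.
by apply: Lfun2D; [exact: Lfun2_lin|exact: Lfun_cst].
Qed.

Lemma mean_vec_affine m n (Z : Omega -> 'cV[R]_n) z (M : 'M[R]_(m, n)) b :
  L2_vector Z -> mean_vec P Z = map_mx EFin z ->
  mean_vec P (fun w => M *m Z w + b) = map_mx EFin (M *m z + b).
Proof.
move=> Z2 EZ; apply/colP => k; rewrite !mxE.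
under eq_fun do rewrite !mxE.
rewrite EFinD -(expectation_lin _ _ Z2) => [|j]; last first.
  by move/colP/(_ j) : EZ; rewrite !mxE.
rewrite -[in RHS](expectation_cst P) -expectationD//; last exact: Lfun_cst.
by apply: Lfun12; exact: Lfun2_lin.
Qed.

Lemma cov_mx_affine m n (Z : Omega -> 'cV[R]_n) S (M : 'M[R]_(m, n)) b :
  L2_vector Z -> cov_mx P Z = map_mx EFin S ->
  cov_mx P (fun w => M *m Z w + b) = map_mx EFin (M *m S *m M^T).
Proof.
move=> Z2 CZ.
have MZ2 k : (fun w => \sum_j M k j * Z w j 0) \in Lfun P 2%:E.
  exact: Lfun2_lin.
have CZ1 k l : covariance P (fun w => Z w k 0) (fun w => Z w l 0) = (S k l)%:E.
  by move/matrixP/(_ k l) : CZ; rewrite !mxE.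
apply/matrixP => k l; rewrite !mxE.
under eq_fun do rewrite !mxE.
under [X in covariance _ _ X]eq_fun do rewrite !mxE.
rewrite covarianceD_cst_l//; last by apply: (Lfun2D (MZ2 l)); exact: Lfun_cst.
rewrite covarianceC covarianceD_cst_l//.
under [in RHS]eq_bigr do rewrite [M^T _ _]mxE mulrC.
apply: covariance_linl => // j; rewrite covarianceC !mxE.
by apply: covariance_linl => // i.
Qed.

Lemma L2_vector_col_mx m n (X : Omega -> 'cV[R]_m) (Y : Omega -> 'cV[R]_n) :
  L2_vector X -> L2_vector Y -> L2_vector (fun w => col_mx (X w) (Y w)).
Proof.
move=> X2 Y2 k; case: (split_ordP k) => j ->.
  by under eq_fun do rewrite col_mxEu; exact: X2.
by under eq_fun do rewrite col_mxEd; exact: Y2.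
Qed.

Lemma mean_vec_col_mx m n (X : Omega -> 'cV[R]_m) (Y : Omega -> 'cV[R]_n) x y :
  mean_vec P X = map_mx EFin x -> mean_vec P Y = map_mx EFin y ->
  mean_vec P (fun w => col_mx (X w) (Y w)) = map_mx EFin (col_mx x y).
Proof.
move=> EX EY; rewrite map_col_mx -EX -EY; apply/colP => k; rewrite mxE.
case: (split_ordP k) => j ->.
  by under eq_fun do rewrite col_mxEu; rewrite col_mxEu mxE.
by under eq_fun do rewrite col_mxEd; rewrite col_mxEd mxE.
Qed.

(** The cross-covariance K stays unspecified; only its finiteness matters, since
    its contribution is later multiplied by a matrix that tends to 0. *)
Lemma cov_mx_col_mx m n (X : Omega -> 'cV[R]_m) (Y : Omega -> 'cV[R]_n) S T :
  L2_vector X -> L2_vector Y ->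
  cov_mx P X = map_mx EFin S -> cov_mx P Y = map_mx EFin T ->
  exists K, cov_mx P (fun w => col_mx (X w) (Y w)) =
    map_mx EFin (block_mx S K K^T T).
Proof.
move=> X2 Y2 CX CY.
exists (\matrix_(i, j)
  fine (covariance P (fun w => X w i 0) (fun w => Y w j 0))).
have CXY i j : covariance P (fun w => X w i 0) (fun w => Y w j 0) \is a fin_num.
  by apply: covariance_fin_num;
    [exact: Lfun12|exact: Lfun12|exact: Lfun2_mul_Lfun1].
rewrite map_block_mx -CX -CY; apply/matrixP => k l; rewrite mxE.
case: (split_ordP k) => i ->; case: (split_ordP l) => j ->.
- by rewrite block_mxEul mxE; congr covariance; apply/funext => w;
    rewrite col_mxEu.
- by rewrite block_mxEur !mxE fineK//; congr covariance;
    apply/funext => w; rewrite ?col_mxEu ?col_mxEd.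
- by rewrite block_mxEdl !mxE fineK// covarianceC; congr covariance;
    apply/funext => w; rewrite ?col_mxEu ?col_mxEd.
- by rewrite block_mxEdr mxE; congr covariance; apply/funext => w;
    rewrite col_mxEd.
Qed.

(** A finite variance makes X_k - fine E[X_k] square integrable, whatever the
    value of this constant; adding it back preserves square integrability since
    the measure is finite. *)
Lemma L2_vector_finite_cov n (X : Omega -> 'cV[R]_n) S :
  random_vector X -> cov_mx P X = map_mx EFin S -> L2_vector X.
Proof.
move=> mX CX k; set Y := fun w => X w k 0.
set c := fine 'E_P[Y]%E.
have mYc : measurable_fun setT (fun w => Y w - c).
  by apply: measurable_funB => //; exact: mX.
have Yc2 : (fun w => Y w - c) \in Lfun P 2%:E.
  apply: Lfun2_sqr_lty => //.
  have : covariance P Y Y = (S k k)%:E by move/matrixP/(_ k k) : CX;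
    rewrite !mxE.
  have -> : covariance P Y Y = (\int[P]_w ((Y w - c) ^+ 2)%:E)%E.
    by rewrite /c !unlock.
  by move=> ->; rewrite ltry.
have -> : Y = (fun w => Y w - c) \+ cst c.
  by apply/funext => w /=; rewrite subrK.
by apply: Lfun2D => //; exact: Lfun_cst.
Qed.

End square_integrable.

(** * Moments of centred Gaussian vectors *)

Section gaussian_moments.
Context (R : realType) (disp : measure_display) (Omega : measurableType disp)
  (P : probability Omega R).

Lemma centred_gaussian_sqr (X : Omega -> R) (v : R) : 0 <= v ->
  measurable_fun setT X ->
  (forall E : set R, measurable E -> P (X @^-1` E) =
    if v == 0 then dirac (0 : R) E else normal_prob 0 (Num.sqrt v) E) ->
  (\int[P]_w (X w ^+ 2)%:E = v%:E)%E.
Proof.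
move=> v_ge0 mX lawX.
have msqr : measurable_fun [set: R] (fun x : R => (x ^+ 2)%:E).
  by apply/measurable_EFinP; exact: measurable_funX.
(* normal_prob lives on the Borel structure measurableTypeR R; retyping the
   codomain makes the image law and normal_prob measures on the same type. *)
pose X' : Omega -> measurableTypeR R := X.
have mX' : measurable_fun setT X' := mX.
have -> : (\int[P]_w (X w ^+ 2)%:E = \int[pushforward P X']_x (x ^+ 2)%:E)%E.
  by rewrite ge0_integral_pushforward// => x _; rewrite lee_fin sqr_ge0.
have [v0|v_neq0] := eqVneq v 0.
  rewrite (eq_measure_integral (dirac (0 : measurableTypeR R))); last first.
    by move=> E mE _; rewrite /= /pushforward lawX// v0 eqxx.
  by rewrite integral_dirac// diracT mul1e expr0n /= v0.
rewrite (eq_measure_integral (normal_prob 0 (Num.sqrt v))); last first.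
  by move=> E mE _; rewrite /= /pushforward lawX// (negPf v_neq0).
rewrite ge0_integral_normal_prob//; last by move=> x; rewrite lee_fin sqr_ge0.
under eq_integral do rewrite -EFinM.
rewrite normal_second_moment ?sqr_sqrtr//.
by rewrite gt_eqF// sqrtr_gt0 lt_neqAle eq_sym v_neq0.
Qed.

Variables (n : nat) (X : Omega -> 'cV[R]_n) (S : 'M[R]_n).
Hypothesis S_spsd : spsd S.
Hypothesis X_gauss : gaussian_vector P X 0 S.

Let mlin (a : 'cV[R]_n) : measurable_fun setT (fun w => (a^T *m X w) 0 0).
Proof.
under eq_fun do rewrite mxE.
apply: measurable_sum => j; apply: measurable_funM => //; exact: X_gauss.1.
Qed.

Let lin_sqr (a : 'cV[R]_n) :
  (\int[P]_w ((a^T *m X w) 0 0 ^+ 2)%:E = ((a^T *m S *m a) 0 0)%:E)%E.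
Proof.
apply: centred_gaussian_sqr (mlin a) _; first exact: S_spsd.2.
by move=> E mE; have := X_gauss.2 a E mE;
  rewrite mulmx0 (_ : (0 : 'M[R]_1) 0 0 = 0)// mxE.
Qed.

Let lin_L2 (a : 'cV[R]_n) : (fun w => (a^T *m X w) 0 0) \in Lfun P 2%:E.
Proof. by apply: (Lfun2_sqr_lty (mlin a)); rewrite lin_sqr ltry. Qed.

(* The functionals given by a and - a have the same centred law, hence the same
   expectation, while the two expectations are opposite. *)
Let lin_mean (a : 'cV[R]_n) : 'E_P[(fun w => (a^T *m X w) 0 0)%R]%E = 0%E.
Proof.
have symE : 'E_P[(fun w => (a^T *m X w) 0 0)%R]%E =
    'E_P[(fun w => ((- a)^T *m X w) 0 0)%R]%E.
  have intP (b : 'cV[R]_n) :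
      P.-integrable setT (EFin \o (fun w => (b^T *m X w) 0 0)).
    by have /Lfun1_integrable := Lfun12 (lin_L2 b).
  rewrite unlock.
  rewrite -(@integral_pushforward _ _ _ _ _ _ (mlin a) P setT EFin)//.
  rewrite -(@integral_pushforward _ _ _ _ _ _ (mlin (- a)) P setT EFin)//.
  apply: eq_measure_integral => E mE _; rewrite /= /pushforward.
  have := X_gauss.2 a E mE; rewrite /= => ->.
  have := X_gauss.2 (- a) E mE; rewrite /= => ->.
  by rewrite !mulmx0 [(- a)^T]linearN !mulNmx mulmxN opprK.
have Efin := expectation_fin_num (Lfun12 (lin_L2 a)).
move: symE.
have -> : (fun w => ((- a)^T *m X w) 0 0) =
    (-1) \o* (fun w => (a^T *m X w) 0 0).
  by apply/funext => w /=; rewrite [(- a)^T]linearN mulNmx mxE mulrN1.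
rewrite expectationZl ?Lfun12// -(fineK Efin) -EFinM => -[] E0.
by congr EFin; lra.
Qed.

Let coordE k : (fun w => X w k 0) =
  (fun w => ((delta_mx k 0 : 'cV[R]_n)^T *m X w) 0 0).
Proof. by apply/funext => w; rewrite trmx_delta -rowE mxE. Qed.

Lemma gaussian_L2_vector : L2_vector P X.
Proof. by move=> k; rewrite coordE. Qed.

Lemma gaussian_mean_vec : mean_vec P X = map_mx EFin 0.
Proof. by apply/colP => k; rewrite !mxE coordE lin_mean. Qed.

(** Polarization: the variances of X_k, X_l and X_k + X_l are quadratic forms in
    S, and determine the covariance of X_k and X_l. *)
Lemma gaussian_cov_mx : cov_mx P X = map_mx EFin S.
Proof.
have varE (a : 'cV[R]_n) :
    'V_P[(fun w => (a^T *m X w) 0 0)%R]%E = ((a^T *m S *m a) 0 0)%:E.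
  by rewrite varianceE// (lin_mean a) expe2 mul0e sube0 -lin_sqr unlock.
apply/matrixP => k l; rewrite !mxE !coordE.
set ek : 'cV[R]_n := delta_mx k 0; set el : 'cV[R]_n := delta_mx l 0.
have fin : covariance P (fun w => (ek^T *m X w) 0 0)
    (fun w => (el^T *m X w) 0 0) \is a fin_num.
  by apply: covariance_fin_num;
    [exact: Lfun12|exact: Lfun12|exact: Lfun2_mul_Lfun1].
have := varianceD (lin_L2 ek) (lin_L2 el).
have -> : (fun w => (ek^T *m X w) 0 0) \+ (fun w => (el^T *m X w) 0 0) =
    (fun w => ((ek + el)^T *m X w) 0 0).
  by apply/funext => w /=; rewrite [(ek + el)^T]linearD mulmxDl [RHS]mxE.
rewrite !varE -(fineK fin) -!EFinM -!EFinD => -[].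
have SE i j :
    ((delta_mx i 0 : 'cV_n)^T *m S *m (delta_mx j 0 : 'cV_n)) 0 0 = S i j.
  by rewrite -colE mxE trmx_delta -rowE mxE.
have Slk : S l k = S k l by rewrite -[in LHS]S_spsd.1 mxE.
rewrite [(ek + el)^T]linearD !mulmxDl !mulmxDr [_ 0 0]mxE.
rewrite [X in X + _]mxE [X in _ + X]mxE !SE Slk => E.
by congr EFin; lra.
Qed.

End gaussian_moments.

(** * Entrywise limits of matrices *)

Lemma cvg_mx_entry (T : topologicalType) (I : Type) (F : set_system I)
    (FF : Filter F) m n (M_ : I -> 'M[T]_(m, n)) (M : 'M[T]_(m, n)) :
  (forall i j, M_ x i j @[x --> F] --> M i j) -> M_ x @[x --> F] --> M.
Proof.
move=> limM A [V V_nbhs VA].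
suff : \forall x \near F, forall i j, V i j (M_ x i j).
  by apply: filterS => x /VA.
by apply: filter_forall => i; apply: filter_forall => j; exact: limM.
Qed.

Lemma cvg_entry (T : topologicalType) (I : Type) (F : set_system I)
    (FF : Filter F) m n (M_ : I -> 'M[T]_(m, n)) (M : 'M[T]_(m, n)) i j :
  M_ x @[x --> F] --> M -> M_ x i j @[x --> F] --> M i j.
Proof.
move=> limM A A_nbhs; apply: (limM [set N | A (N i j)]).
exists (fun k l => if (k == i) && (l == j) then A else setT).
  by move=> k l; case: ifP => [/andP[/eqP-> /eqP->]|_]//; exact: filterT.
by move=> N /(_ i j); rewrite !eqxx.
Qed.

Section matrix_limits.
Context (R : realType) (I : Type) (F : set_system I) {FF : Filter F}.

Lemma cvg_map_EFin m n (M_ : I -> 'M[R]_(m, n)) (M : 'M[R]_(m, n)) :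
  M_ x @[x --> F] --> M ->
  map_mx EFin (M_ x) @[x --> F] --> map_mx EFin M.
Proof.
move=> limM; apply: cvg_mx_entry => i j; rewrite mxE;
  under eq_fun do rewrite mxE.
by apply: cvg_EFin; [near=> x|exact: cvg_entry].
Unshelve. all: by end_near. Qed.

Lemma cvg_mulmx m n k (M_ : I -> 'M[R]_(m, n)) (N_ : I -> 'M[R]_(n, k))
    (M : 'M[R]_(m, n)) (N : 'M[R]_(n, k)) :
  M_ x @[x --> F] --> M -> N_ x @[x --> F] --> N ->
  M_ x *m N_ x @[x --> F] --> M *m N.
Proof.
move=> limM limN; apply: cvg_mx_entry => i j; rewrite mxE.
under eq_fun do rewrite mxE.
apply: cvg_big => [|l _]; first exact: add_continuous.
by apply: cvgM; exact: cvg_entry.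
Qed.

Lemma cvg_trmx m n (M_ : I -> 'M[R]_(m, n)) (M : 'M[R]_(m, n)) :
  M_ x @[x --> F] --> M -> (M_ x)^T @[x --> F] --> M^T.
Proof.
move=> limM; apply: cvg_mx_entry => i j; rewrite mxE.
by under eq_fun do rewrite mxE; exact: cvg_entry.
Qed.

Lemma cvg_row_mx m n k (M_ : I -> 'M[R]_(m, n)) (N_ : I -> 'M[R]_(m, k))
    (M : 'M[R]_(m, n)) (N : 'M[R]_(m, k)) :
  M_ x @[x --> F] --> M -> N_ x @[x --> F] --> N ->
  row_mx (M_ x) (N_ x) @[x --> F] --> row_mx M N.
Proof.
move=> limM limN; apply: cvg_mx_entry => i j; case: (split_ordP j) => l ->.
  by rewrite row_mxEl; under eq_fun do rewrite row_mxEl; exact: cvg_entry.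
by rewrite row_mxEr; under eq_fun do rewrite row_mxEr; exact: cvg_entry.
Qed.

End matrix_limits.

(** * Limits of moments of affine images *)

Section affine_limits.
Context (R : realType) (disp : measure_display) (Omega : measurableType disp)
  (P : probability Omega R).

Lemma moments_affine_cvg m n (Z : Omega -> 'cV[R]_n) (z : 'cV[R]_n)
    (S : 'M[R]_n)
    (M_ : nat -> 'M[R]_(m, n)) (b_ : nat -> 'cV[R]_m)
    (M : 'M[R]_(m, n)) (b : 'cV[R]_m) :
  L2_vector P Z -> mean_vec P Z = map_mx EFin z -> cov_mx P Z = map_mx EFin S ->
  M_ i @[i --> \oo] --> M -> b_ i @[i --> \oo] --> b ->
  mean_vec P (fun w => M_ i *m Z w + b_ i) @[i --> \oo]
    --> map_mx EFin (M *m z + b) /\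
  cov_mx P (fun w => M_ i *m Z w + b_ i) @[i --> \oo]
    --> map_mx EFin (M *m S *m M^T).
Proof.
move=> Z2 EZ CZ limM limb; split.
  under eq_fun do rewrite (mean_vec_affine _ _ Z2 EZ).
  apply: cvg_map_EFin; apply: cvgD => //.
  by apply: cvg_mulmx => //; exact: cvg_cst.
under eq_fun do rewrite (cov_mx_affine _ _ Z2 CZ).
apply: cvg_map_EFin; apply: cvg_mulmx; last exact: cvg_trmx.
by apply: cvg_mulmx => //; exact: cvg_cst.
Qed.

End affine_limits.

(** * The projected iteration *)

(** U U^T B M_(i:0) = U diag(lam) U^T B, and lam decays geometrically. *)
Lemma mf_projected_Mprod_cvg0 (R : realType) d r (B C0 : 'M[R]_d)
    (U : 'M[R]_(d, r)) :
  spd B -> spsd C0 ->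
  (forall i, exists delta : 'I_r -> R, (forall l, 0 < delta l) /\
     forall l, mf_C B C0 i *m B *m col l U = delta l *: col l U) ->
  U^T *m B *m U = 1%:M ->
  U *m U^T *m B *m mf_Mprod B C0 i @[i --> \oo] --> (0 : 'M[R]_d).
Proof.
move=> Bspd C0spsd CBU UBU; have [delta0 [d0_gt0 CBU0]] := CBU 0%N.
have decay := mf_spectral_decay Bspd C0spsd d0_gt0 CBU0 CBU UBU.
have [lam lamP] := choice (fun i => decay i.+1).
have NE i : U *m U^T *m B *m mf_Mprod B C0 i =
    U *m diag_mx (\row_l lam i l) *m (U^T *m B).
  by rewrite -!mulmxA [U^T *m _]mulmxA (lamP i).1.
have lam_cvg0 l : lam i l @[i --> \oo] --> (0 : R).
  have f_gt0 : 0 < eigen_floor (delta0 l) by rewrite divr_gt0// addr_gt0.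
  have q_lt1 : `|(1 + eigen_floor (delta0 l))^-1| < 1.
    by rewrite ger0_norm ?invr_ge0 ?addr_ge0 ?ltW// invf_lt1 ?ltrDl// addr_gt0.
  apply: (@squeeze_cvgr _ _ _ _ (cst 0)
      (fun i => (1 + eigen_floor (delta0 l))^-1 ^+ i.+1)).
  - by apply: nearW => i; exact: (lamP i).2.
  - exact: cvg_cst.
  - by rewrite cvg_shiftS; exact: cvg_expr.
under eq_fun do rewrite NE.
rewrite -(mul0mx _ (U^T *m B)) -(mulmx0 _ U).
apply: cvg_mulmx; last exact: cvg_cst.
apply: cvg_mulmx; first exact: cvg_cst.
apply: cvg_mx_entry => i j; rewrite mxE; under eq_fun do rewrite !mxE.
case: eqP => _; first exact: lam_cvg0.
exact: cvg_cst.
Qed.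

(** In block form HR^T GR^-1 is the row (H^T G^-1, Gpr^-1): the regularization
    block adds the prior precision to that of the data, and only sees the zero
    part of the augmented data. *)
Lemma bt_precision (R : realType) n d (H : 'M[R]_(n, d)) (G : 'M[R]_n)
    (Gpr : 'M[R]_d) (y : 'cV[R]_n) : G \in unitmx -> Gpr \in unitmx ->
  let HR := col_mx H 1%:M in let GR := block_mx G 0 0 Gpr in
  HR^T *m invmx GR *m HR = H^T *m invmx G *m H + invmx Gpr /\
  HR^T *m invmx GR *m col_mx y 0 = H^T *m invmx G *m y.
Proof.
move=> Gu Gpru HR GR.
have -> : HR^T *m invmx GR = row_mx (H^T *m invmx G) (invmx Gpr).
  rewrite invmx_block_diag// tr_col_mx mul_row_block !mulmx0 addr0 add0r.
  by rewrite trmx1 mul1mx.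
by rewrite !mul_row_col mulmx1 mulmx0 addr0.
Qed.

(** The data y only enters the shift; all the randomness of the projected
    particle sits in the stacked vector (v; e). *)
Lemma projected_particleE (R : realType) d n (Pi N : 'M[R]_d) (K : 'M[R]_(d, n))
    (v : 'cV[R]_d) (y e : 'cV[R]_n) :
  Pi *m (N *m v + (1%:M - N) *m (K *m (y + e))) =
  row_mx (Pi *m N) ((Pi - Pi *m N) *m K) *m col_mx v e
    + (Pi - Pi *m N) *m K *m y.
Proof.
rewrite mul_row_col mulmxDr !mulmxA mulmxBr mulmx1 mulmxDr -addrA.
by congr (_ + _); rewrite addrC.
Qed.

Theorem corollary4p1 (R : realType) (d dout m : nat)
  (* linear system, observation times, data *)
  (A : 'M[R]_d) (F : 'M[R]_(dout, d)) (t : 'I_m -> R)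
  (t_gt0 : forall k, 0 < t k)
  (t_incr : forall k k' : 'I_m, (k < k')%N -> t k < t k')
  (Gamma_eta : 'M[R]_dout) (Gamma_eta_spd : spd Gamma_eta)
  (Gamma_pr : 'M[R]_d) (Gamma_pr_spd : spd Gamma_pr)
  (yk : 'I_m -> 'cV[R]_dout)
  (* balanced truncation of order rho *)
  (l p rho : nat) (Rpr : 'M[R]_(d, p)) (L : 'M[R]_(d, l))
  (Phi : 'M[R]_l) (Xi : 'M[R]_(l, p)) (Psi : 'M[R]_p)
  (hl : (rho <= l)%N) (hp : (rho <= p)%N)
  (Q_converges : obs_gramian_converges A F Gamma_eta)
  (Gamma_pr_factor : Gamma_pr = Rpr *m Rpr^T)
  (Q_factor : obs_gramian A F Gamma_eta = L *m L^T)
  (svd_LR : is_svd (L^T *m Rpr) Phi Xi Psi)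
  (Xi_rho_unit : leading_block hl hp Xi \in unitmx) :
  let Gamma := stack_noise_cov m Gamma_eta in
  let y := \mxcol_(k < m) yk k in
  let H_BT :=
    bt_H A F t (bt_Vt hl hp L Phi Xi) (bt_U hl hp Rpr Xi Psi) in
  let H_RLS := col_mx H_BT 1%:M in
  let y_RLS := col_mx y 0 in
  let Gamma_RLS := block_mx Gamma 0 0 Gamma_pr in
  let B := H_RLS^T *m invmx Gamma_RLS *m H_RLS in
  let Gamma_pos := invmx (H_BT^T *m invmx Gamma *m H_BT + invmx Gamma_pr) in
  let mu_pos := Gamma_pos *m H_BT^T *m invmx Gamma *m y in
  forall
  (* random initial particles and perturbations *)
  (disp : measure_display) (Omega : measurableType disp)
  (P : probability Omega R)
  (J : nat) (mu0 : 'cV[R]_d) (C0 : 'M[R]_d) (C0_spsd : spsd C0)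
  (v0 : 'I_J -> Omega -> 'cV[R]_d)
  (eps : 'I_J -> Omega -> 'cV[R]_(\sum_(k < m) dout + d))
  (v0_random : forall j, random_vector (v0 j))
  (v0_mean : forall j, mean_vec P (v0 j) = map_mx EFin mu0)
  (v0_cov : forall j, cov_mx P (v0 j) = map_mx EFin C0)
  (eps_gaussian : forall j, gaussian_vector P (eps j) 0 Gamma_RLS)
  (eps_indep : mutually_independent P
     (fun j => sigma_generated (fun _ : unit => eps j)))
  (eps_v0_indep : independent P (sigma_generated v0) (sigma_generated eps))
  (* normalized eigenvectors for the positive eigenvalues, common to all i *)
  (r : nat) (U : 'M[R]_(d, r))
  (U_eigen : forall i, exists delta : 'I_r -> R,
     positive_eigenpairs (mf_C B C0 i *m B) delta U)
  (U_normalized : U^T *m B *m U = 1%:M),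
  let Pi := U *m U^T *m B in
  let vstar := fun (j : 'I_J) (w : Omega) =>
    mpinv B *m H_RLS^T *m invmx Gamma_RLS *m (y_RLS + eps j w) in
  let vS := fun (i : nat) (j : 'I_J) (w : Omega) =>
    mf_vS B C0 (v0 j w) (vstar j w) i in
  forall j : 'I_J,
    mean_vec P (fun w => Pi *m vS i j w) @[i --> \oo]
      --> map_mx EFin (Pi *m mu_pos)
    /\
    cov_mx P (fun w => Pi *m vS i j w) @[i --> \oo]
      --> map_mx EFin (Pi *m Gamma_pos *m Pi^T).
Proof.
move=> Gamma y H_BT H_RLS y_RLS Gamma_RLS B Gamma_pos mu_pos.
move=> disp Omega P J mu0 C0 C0_spsd v0 eps v0_random v0_mean v0_cov.
move=> eps_gaussian _ _ r U U_eigen UBU.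
move=> Pi vstar vS j.
have Gamma_spd : spd Gamma by exact: spd_mxdiag.
have GR_spd : spd Gamma_RLS by exact: spd_block_diag.
have B_spd : spd B.
  apply: spd_congr; first exact: spd_invmx.
  by move=> x /(congr1 dsubmx); rewrite mul_col_mx mul1mx col_mxKd linear0.
have [BE By] :=
  bt_precision H_BT y (spd_unitmx Gamma_spd) (spd_unitmx Gamma_pr_spd).
have B_unit := spd_unitmx B_spd.
have GposE : Gamma_pos = invmx B by rewrite /Gamma_pos -BE.
pose K := mpinv B *m H_RLS^T *m invmx Gamma_RLS.
have KyE : K *m y_RLS = mu_pos.
  by rewrite /K /mu_pos GposE mpinv_unitmx// -!mulmxA; congr (_ *m _);
    rewrite !mulmxA.
have KGK : K *m Gamma_RLS *m K^T = Gamma_pos.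
  rewrite GposE /K mpinv_unitmx// mulmxKV ?spd_unitmx//.
  rewrite !trmx_mul trmxK !trmx_inv GR_spd.1 B_spd.1 -!mulmxA (mulmxA H_RLS^T).
  by rewrite (mulmxA _ H_RLS) mulmxV// mulmx1.
pose N i := Pi *m mf_Mprod B C0 i.
have N_cvg : N i @[i --> \oo] --> (0 : 'M[R]_d).
  apply: mf_projected_Mprod_cvg0 => // i.
  by have [delta [d_gt0 _ dU]] := U_eigen i; exists delta.
pose T i := (Pi - N i) *m K.
have T_cvg : T i @[i --> \oo] --> Pi *m K.
  rewrite -[Pi in X in _ --> X]subr0; apply: cvg_mulmx; last exact: cvg_cst.
  by apply: cvgB => //; exact: cvg_cst.
pose Z w := col_mx (v0 j w) (eps j w).
have vSE i w : Pi *m vS i j w = row_mx (N i) (T i) *m Z w + T i *m y_RLS.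
  exact: projected_particleE.
have v0_L2 := L2_vector_finite_cov (v0_random j) (v0_cov j).
have GR_spsd := spd_spsd GR_spd.
have eps_L2 := gaussian_L2_vector GR_spsd (eps_gaussian j).
have eps_mean := gaussian_mean_vec GR_spsd (eps_gaussian j).
have eps_cov := gaussian_cov_mx GR_spsd (eps_gaussian j).
have [X Z_cov] := cov_mx_col_mx v0_L2 eps_L2 (v0_cov j) eps_cov.
have [mean_cvg cov_cvg] := moments_affine_cvg (L2_vector_col_mx v0_L2 eps_L2)
  (mean_vec_col_mx (v0_mean j) eps_mean) Z_cov (cvg_row_mx N_cvg T_cvg)
  (cvg_mulmx T_cvg (cvg_cst y_RLS)).
split.
  under eq_fun do under eq_fun do rewrite vSE.
  move: mean_cvg; rewrite mul_row_col mul0mx mulmx0 !add0r.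
  by rewrite -mulmxA KyE.
under eq_fun do under eq_fun do rewrite vSE.
have covE : Pi *m K *m Gamma_RLS *m (Pi *m K)^T = Pi *m Gamma_pos *m Pi^T.
  by rewrite -KGK trmx_mul !mulmxA.
move: cov_cvg; rewrite mul_row_block !mul0mx !add0r tr_row_mx mul_row_col.
by rewrite trmx0 mulmx0 add0r covE.
Qed.
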